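(* Let $S$ be a complete semiring, $(\mathbf{C},\otimes,I)$ a small strict monoidal category, $\mathcal{F}$ a system of fields and $\mathbb{T}$ a system of $\mathbf{C}$-valued action exponentials. If $\phi:M\to N$ is a homeomorphism of closed $n$-manifolds, then the coboundary aggregates satisfy $\phi_*\mathfrak{A}(M)=\mathfrak{A}(N)$. That is, the coboundary aggregate is a topological invariant.
   Context: A semiring $(S,+,\cdot,0,1)$ consists of a commutative monoid $(S,+,0)$ and a (not necessarily commutative) monoid $(S,\cdot,1)$ such that $\cdot$ distributes over $+$ from both sides and $0$ is absorbing. A complete monoid is a commutative monoid $(M,+,0)$ with a summation law assigning to every family $(m_i)_{i\in I}$, $I$ an arbitrary set, an element $\sum_{i\in I}m_i$ such that $\sum_{i\in\varnothing}m_i=0$, $\sum_{i\in\{1\}}m_i=m_1$, $\sum_{i\in\{1,2\}}m_i=m_1+m_2$, and $\sum_{j\in J}\big(\sum_{i\in I_j}m_i\big)=\sum_{i\in I}m_i$ for every partition $I=\bigcup_{j\in J}I_j$. A semiring is complete if $(S,+,0,\sum)$ is a complete monoid and $\sum_i ss_i=s\sum_i s_i$, $\sum_i s_is=(\sum_i s_i)s$. $Q=Q_S(\mathbf{C})$ is the complete monoid of functions $\operatorname{Mor}(\mathbf{C})\to S$ with pointwise addition and summation. Fix an integer $n\ge 0$. Manifolds are topological and need not be orientable; $\varnothing$ is a manifold of every dimension; $\sqcup$ is the ordered disjoint union. A bordism from $M$ to $N$ is a triple $(W,M,N)$ (often abbreviated $W$) with $W$ a compact $(n+1)$-dimensional topological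 manifold, $\partial W=M\sqcup N$, where the closed $n$-manifolds $M,N$ are the incoming and outgoing boundary. $(W,M,N)\sqcup(W',M',N')=(W\sqcup W',M\sqcup M',N\sqcup N')$. If $W'$ is a bordism from $M$ to $N$ and $W''$ a bordism from $N$ to $P$, gluing along $N$ yields the bordism $W'\cup_N W''$ from $M$ to $P$. A homeomorphism of bordisms is a homeomorphism preserving incoming and outgoing boundaries. $(W_0,M_0,N_0)$ is a subbordism of $(W,M,N)$ if $W_0\subset W$ is a codimension $0$ submanifold, every connected component $C$ of $M_0$ satisfies $C\cap\partial W=\varnothing$ or $C\subset M$, and every connected component $C$ of $N_0$ satisfies $C\cap\partial W=\varnothing$ or $C\subset N$. A system $\mathcal{F}$ of fields assigns to each bordism $W$ a set $\mathcal{F}(W)$ and to each closed $n$-manifold $M$ a set $\mathcal{F}(M)$, with $\mathcal{F}(\varnothing)$ a one-element set, such that: (FRES) There are restriction maps $\mathcal{F}(W)\to\mathcal{F}(W_0)$ for subbordisms $W_0\subset W$, $\mathcal{F}(M)\to\mathcal{F}(M_0)$ for codimension $0$ submanifolds $M_0\subset M$, and $\mathcal{F}(W)\to\mathcal{F}(M)$ for closed codimension $1$ submanifolds $M\subset W$; they are written $f\mapsto f|_{(-)}$ and commute with each other in the obvious way (restricting in stages equals restricting directly). (FHOMEO) A homeomorphism of bordisms $\phi:W\to W'$ induces a bijection $\phi^*:\mathcal{F}(W')\to\mathcal{F}(W)$ with $(\operatorname{id}_W)^*=\operatorname{id}$, $(\psi\circ\phi)^*=\phi^*\circ\psi^*$;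 similarly for homeomorphisms of closed $n$-manifolds; these maps commute with the restriction maps. (FDISJ) The products of restrictions $\mathcal{F}(W\sqcup W')\to\mathcal{F}(W)\times\mathcal{F}(W')$ and $\mathcal{F}(M\sqcup N)\to\mathcal{F}(M)\times\mathcal{F}(N)$ are bijections. (FGLUE) For $W=W'\cup_N W''$, the map $\mathcal{F}(W)\to\mathcal{F}(W')\times_{\mathcal{F}(N)}\mathcal{F}(W'')$ given by the restrictions to $W'$ and $W''$ is a bijection onto the pullback. A system $\mathbb{T}$ of $\mathbf{C}$-valued action exponentials consists of functions $\mathbb{T}_W:\mathcal{F}(W)\to\operatorname{Mor}(\mathbf{C})$ for all bordisms $W$ with $\mathbb{T}_\varnothing(p)=\operatorname{id}_I$ ($p$ the unique element of $\mathcal{F}(\varnothing)$) such that: (TDISJ) $\mathbb{T}_{W\sqcup W'}(f)=\mathbb{T}_W(f|_W)\otimes\mathbb{T}_{W'}(f|_{W'})$; (TGLUE) for $W=W'\cup_NW''$, $\mathbb{T}_W(f)=\mathbb{T}_{W''}(f|_{W''})\circ\mathbb{T}_{W'}(f|_{W'})$; (THOMEO) for a homeomorphism of bordisms $\phi:W\to W'$ and $f\in\mathcal{F}(W')$, $\mathbb{T}_W(\phi^*f)=\mathbb{T}_{W'}(f)$. For a closed $n$-manifold $M$, the state module $Z(M)$ is the set of functions $z:\mathcal{F}(M)\to Q$ with $z(\phi^*f)=z(f)$ for all $f$ and all homeomorphisms $\phi:M\to M$ isotopic to the identity; it is a complete monoid under pointwise addition and summation. A homeomorphism $\phi:M\to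 N$ induces $\phi_*:Z(M)\to Z(N)$, $\phi_*(z)(g)=z(\phi^*g)$. For a bordism $W$ and $F\in\mathcal{F}(W)$, $T_W(F)\in Q$ is the characteristic function of the morphism $\mathbb{T}_W(F)$ (value $1\in S$ at $\mathbb{T}_W(F)$, $0$ elsewhere). For $f\in\mathcal{F}(\partial W)$ let $\mathcal{F}(W,f)=\{F\in\mathcal{F}(W)\mid F|_{\partial W}=f\}$. The state sum $Z_W\in Z(\partial W)$ is $Z_W(f)=\sum_{F\in\mathcal{F}(W,f)}T_W(F)\in Q$. Two bordisms $(W_1,\varnothing,M)$ and $(W_2,\varnothing,M)$ are equivalent if there is a homeomorphism $W_1\cong W_2$ whose restriction to the boundary is the identity on $M$; $\operatorname{Cob}(M)$ is the collection of equivalence classes. Equivalent bordisms have equal state sums, so $Z_{[W]}:=Z_W\in Z(M)$ is well defined for $[W]\in\operatorname{Cob}(M)$. The coboundary aggregate of $M$ is $\mathfrak{A}(M)=\sum_{[W]\in\operatorname{Cob}(M)}Z_{[W]}\in Z(M)$. *)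

(* Defs.v *)
From HB Require Import structures.
From mathcomp Require Import all_boot all_order all_algebra.
From mathcomp Require Import all_classical all_reals all_analysis.
Import Order.TTheory GRing.Theory Num.Theory.
Import numFieldNormedType.Exports.

Set Implicit Arguments.
Unset Strict Implicit.
Unset Printing Implicit Defensive.

Local Open Scope classical_set_scope.
Local Open Scope ring_scope.

(* Index sets are arbitrary types.  A set-theoretic index set {1} or {1,2} is
   any type with exactly one, resp. two, elements; this is what makes
   summation invariant under bijective reindexing (csum_reindex below). *)
HB.mixin Record Nmodule_isComplete M & GRing.Nmodule M := {
  csum : forall I : Type, (I -> M) -> M;
  csum_empty : forall (I : Type) (m : I -> M), (I -> False) -> csum I m = 0;
  csum_single : forall (I : Type) (m : I -> M) (i0 : I),
    (forall i, i = i0) -> csum I m = m i0;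
  csum_pair : forall (I : Type) (m : I -> M) (i1 i2 : I),
    i1 <> i2 -> (forall i, i = i1 \/ i = i2) -> csum I m = m i1 + m i2;
  (* the blocks of the partition of I are the P j, for j : J *)
  csum_partition : forall (I J : Type) (m : I -> M) (P : J -> I -> Prop),
    (forall j1 j2 i, P j1 i -> P j2 i -> j1 = j2) ->
    (forall i, exists j, P j i) ->
    csum J (fun j => csum {i : I | P j i} (fun i => m (sval i))) = csum I m
}.

#[short(type="completeNmodType")]
HB.structure Definition CompleteNmodule :=
  {M of GRing.Nmodule M & Nmodule_isComplete M}.

HB.mixin Record CompleteNmodule_isCompleteSemiRing S
    & CompleteNmodule S & GRing.PzSemiRing S := {
  csumMl : forall (I : Type) (s : S) (m : I -> S),
    csum I (fun i => s * m i) = s * csum I m;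
  csumMr : forall (I : Type) (s : S) (m : I -> S),
    csum I (fun i => m i * s) = csum I m * s
}.

#[short(type="completeSemiRingType")]
HB.structure Definition CompleteSemiRing :=
  {S of GRing.PzSemiRing S & CompleteNmodule S &
        CompleteNmodule_isCompleteSemiRing S}.

Arguments csum {M I} m : rename.

Lemma csum_reindex (M : completeNmodType) (I J : Type) (h : J -> I)
    (m : I -> M) :
  bijective h -> csum (fun j => m (h j)) = csum m.
Proof.
move=> [g hK gK].
rewrite -(@csum_partition M I J m (fun j i => g i = j)).
- congr csum; apply/funext => j.
  rewrite (@csum_single M _ _ (exist (fun i => g i = j) (h j) (hK j))) //.
  move=> [i e]; apply: eq_exist => /=.
  by rewrite -e gK.
- by move=> j1 j2 i <- <-.
- by move=> i; exists (g i).
Qed.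

Record strict_monoidal_category := StrictMonoidalCategory {
  Ob : Type;
  Mor : Type;
  dom : Mor -> Ob;
  cod : Mor -> Ob;
  idm : Ob -> Mor;
  (* comp g f _ is the composite of f followed by g *)
  comp : forall g f : Mor, dom g = cod f -> Mor;
  dom_idm : forall X, dom (idm X) = X;
  cod_idm : forall X, cod (idm X) = X;
  dom_comp : forall g f (e : dom g = cod f), dom (comp e) = dom f;
  cod_comp : forall g f (e : dom g = cod f), cod (comp e) = cod g;
  comp_idl : forall f (e : dom (idm (cod f)) = cod f), comp e = f;
  comp_idr : forall f (e : dom f = cod (idm (dom f))), comp e = f;
  comp_assoc : forall h g f (ehg : dom h = cod g) (egf : dom g = cod f)
    (e1 : dom h = cod (comp egf)) (e2 : dom (comp ehg) = cod f),
    comp e1 = comp e2;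
  unitO : Ob;
  tensO : Ob -> Ob -> Ob;
  tensM : Mor -> Mor -> Mor;
  dom_tensM : forall f g, dom (tensM f g) = tensO (dom f) (dom g);
  cod_tensM : forall f g, cod (tensM f g) = tensO (cod f) (cod g);
  tensM_idm : forall X Y, tensM (idm X) (idm Y) = idm (tensO X Y);
  tensM_comp : forall g f g' f' (e : dom g = cod f) (e' : dom g' = cod f')
    (ee' : dom (tensM g g') = cod (tensM f f')),
    tensM (comp e) (comp e') = comp ee';
  tensO_assoc : forall X Y Z, tensO X (tensO Y Z) = tensO (tensO X Y) Z;
  tensM_assoc : forall f g h, tensM f (tensM g h) = tensM (tensM f g) h;
  tensO_unitl : forall X, tensO unitO X = X;
  tensO_unitr : forall X, tensO X unitO = X;
  tensM_unitl : forall f, tensM (idm unitO) f = f;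
  tensM_unitr : forall f, tensM f (idm unitO) = f
}.

(* X carries the topology induced by an injection into Y. *)
Record embedding (X Y : topologicalType) := Embedding {
  emb_fun :> X -> Y;
  emb_inj : injective emb_fun;
  emb_open : forall U : set X,
    open U <-> exists2 V : set Y, open V & U = emb_fun @^-1` V
}.

Record homeomorphism (X Y : topologicalType) := Homeomorphism {
  homeo_fun :> X -> Y;
  homeo_inv : Y -> X;
  homeo_funK : cancel homeo_fun homeo_inv;
  homeo_invK : cancel homeo_inv homeo_fun;
  homeo_continuous : continuous homeo_fun;
  homeo_inv_continuous : continuous homeo_inv
}.

Definition homeomorphic_sets (X Y : topologicalType) (A : set X) (B : set Y) :=
  exists (f : X -> Y) (g : Y -> X),
    [/\ f @` A `<=` B, g @` B `<=` A,
        {in A, cancel f g}, {in B, cancel g f} &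
        {within A, continuous f} /\ {within B, continuous g}].

Definition homeo_id (X : topologicalType) : homeomorphism X X :=
  @Homeomorphism X X id id (frefl _) (frefl _) (fun=> cvg_id) (fun=> cvg_id).

Definition homeo_comp (X Y Z : topologicalType)
  (g : homeomorphism Y Z) (f : homeomorphism X Y) : homeomorphism X Z :=
  @Homeomorphism X Z (g \o f) (homeo_inv f \o homeo_inv g)
    (can_comp (homeo_funK g) (homeo_funK f))
    (can_comp (homeo_invK f) (homeo_invK g))
    (fun x => continuous_comp (@homeo_continuous _ _ f x)
                              (@homeo_continuous _ _ g _))
    (fun x => continuous_comp (@homeo_inv_continuous _ _ g x)
                              (@homeo_inv_continuous _ _ f _)).

Definition homeo_sym (X Y : topologicalType) (f : homeomorphism X Y) :
    homeomorphism Y X :=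
  @Homeomorphism Y X (homeo_inv f) f (homeo_invK f) (homeo_funK f)
    (@homeo_inv_continuous _ _ f) (@homeo_continuous _ _ f).

Definition isotopic_to_id (R : realType) (X : topologicalType)
    (phi : homeomorphism X X) :=
  exists H : R * X -> X,
    [/\ {within `[0 : R, 1]%classic `*` [set: X], continuous H},
        forall t : R, 0 <= t <= 1 ->
          exists h : homeomorphism X X, forall x, H (t, x) = h x,
        forall x, H (0, x) = x &
        forall x, H (1, x) = phi x].

Section Manifolds.
Variables (R : realType) (n : nat).

Definition euclidean_at (X : topologicalType) (x : X) :=
  exists (U : set X) (V : set 'rV[R]_n),
    [/\ open U, U x, open V & homeomorphic_sets U V].

Record closed_manifold := ClosedManifold {
  cm_space :> topologicalType;
  cm_hausdorff : hausdorff_space cm_space;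
  cm_second_countable : @second_countable cm_space;
  cm_euclidean : forall x : cm_space, euclidean_at x;
  cm_compact : compact [set: cm_space]
}.

End Manifolds.

Section ManifoldsWithBoundary.
Variables (R : realType) (n : nat).

Definition half_space : set 'rV[R]_n.+1 := [set v | 0 <= v ord0 ord0].

Definition half_euclidean_at (X : topologicalType) (x : X) :=
  exists (U : set X) (V : set 'rV[R]_n.+1),
    [/\ open U, U x, open V & homeomorphic_sets U (V `&` half_space)].

(* By invariance of domain this is the set of points sent to the boundary of
   half_space by some, equivalently every, chart. *)
Definition manifold_boundary (X : topologicalType) : set X :=
  [set x | ~ euclidean_at R n.+1 x].

(* The closed manifolds M and N are abstract spaces, identified with the two
   parts of the boundary of W by b_in and b_out. *)
Record bordism (M N : closed_manifold R n) := Bordism {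
  b_space :> topologicalType;
  b_hausdorff : hausdorff_space b_space;
  b_second_countable : @second_countable b_space;
  b_half_euclidean : forall x : b_space, half_euclidean_at x;
  b_compact : compact [set: b_space];
  b_in : embedding M b_space;
  b_out : embedding N b_space;
  b_boundary : range b_in `|` range b_out = @manifold_boundary b_space;
  b_disjoint : range b_in `&` range b_out = set0
}.

Record bordism_homeo M N M' N' (W : bordism M N) (W' : bordism M' N') :=
  BordismHomeo {
    bh_homeo :> homeomorphism W W';
    bh_in : bh_homeo @` range (b_in W) = range (b_in W');
    bh_out : bh_homeo @` range (b_out W) = range (b_out W')
  }.

(* A subbordism W0 of W is given by its inclusion map. *)
Record subbordism M0 N0 M N (W0 : bordism M0 N0) (W : bordism M N) :=
  Subbordism {
    sub_emb :> embedding W0 W;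
    sub_in : forall x : M0,
      let C := (sub_emb \o b_in W0) @` connected_component [set: M0] x in
      C `&` @manifold_boundary W = set0 \/ C `<=` range (b_in W);
    sub_out : forall x : N0,
      let C := (sub_emb \o b_out W0) @` connected_component [set: N0] x in
      C `&` @manifold_boundary W = set0 \/ C `<=` range (b_out W)
  }.

(* M = M1 |_| M2 via the inclusions i1 and i2, in this order. *)
Definition is_disjoint_union_mfd (M1 M2 M : closed_manifold R n)
    (i1 : embedding M1 M) (i2 : embedding M2 M) :=
  range i1 `|` range i2 = setT /\ range i1 `&` range i2 = set0.

(* (W,M,N) = (W1,M1,N1) |_| (W2,M2,N2) via the inclusions j1 and j2, in this
   order.  All spaces are compact Hausdorff, so W is automatically the
   topological sum of W1 and W2. *)
Definition is_disjoint_union M1 N1 M2 N2 M N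
    (W1 : bordism M1 N1) (W2 : bordism M2 N2) (W : bordism M N)
    (j1 : subbordism W1 W) (j2 : subbordism W2 W) :=
  [/\ range j1 `|` range j2 = setT,
      range j1 `&` range j2 = set0,
      range (b_in W) = range (j1 \o b_in W1) `|` range (j2 \o b_in W2) &
      range (b_out W) = range (j1 \o b_out W1) `|` range (j2 \o b_out W2)].

(* W is obtained by gluing W' and W'' along N, with inclusions j' and j''.
   All spaces are compact Hausdorff, so W automatically carries the quotient
   topology of the pushout. *)
Definition is_gluing M N P
    (W' : bordism M N) (W'' : bordism N P) (W : bordism M P)
    (j' : subbordism W' W) (j'' : subbordism W'' W) :=
  [/\ forall x : N, j' (b_out W' x) = j'' (b_in W'' x),
      forall x : M, j' (b_in W' x) = b_in W x,
      forall x : P, j'' (b_out W'' x) = b_out W x,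
      range j' `|` range j'' = setT &
      range j' `&` range j'' = range (j' \o b_out W')].

(* fieldB and fieldM are the values of the system on bordisms and on closed
   manifolds; resXY restricts fields on an X to fields on a Y (B for bordisms,
   M for closed manifolds).
   Submanifolds are represented by their inclusion maps, hence "restricting in
   stages" and "commuting with restrictions" are stated for every composable,
   resp. commuting, configuration of inclusions. *)
Record field_system := FieldSystem {
  fieldB : forall M N, bordism M N -> Type;
  fieldM : closed_manifold R n -> Type;
  fieldB_empty : forall M N (W : bordism M N), (W -> False) ->
    exists p : fieldB W, forall q, q = p;
  fieldM_empty : forall M : closed_manifold R n, (M -> False) ->
    exists p : fieldM M, forall q, q = p;

  resBB : forall M0 N0 M N (W0 : bordism M0 N0) (W : bordism M N),
    subbordism W0 W -> fieldB W -> fieldB W0;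
  resMM : forall M0 M : closed_manifold R n,
    embedding M0 M -> fieldM M -> fieldM M0;
  resBM : forall M N (W : bordism M N) (L : closed_manifold R n),
    embedding L W -> fieldB W -> fieldM L;
  resBB_resBB : forall M0 N0 M1 N1 M2 N2
    (W0 : bordism M0 N0) (W1 : bordism M1 N1) (W2 : bordism M2 N2)
    (j01 : subbordism W0 W1) (j12 : subbordism W1 W2) (j02 : subbordism W0 W2),
    (forall x, j02 x = j12 (j01 x)) ->
    forall f, resBB j02 f = resBB j01 (resBB j12 f);
  resBM_resBB : forall M0 N0 M N (W0 : bordism M0 N0) (W : bordism M N)
    (L : closed_manifold R n)
    (i0 : embedding L W0) (j : subbordism W0 W) (i : embedding L W),
    (forall x, i x = j (i0 x)) ->
    forall f, resBM i f = resBM i0 (resBB j f);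
  resMM_resBM : forall M N (W : bordism M N) (L0 L : closed_manifold R n)
    (k : embedding L0 L) (i : embedding L W) (i0 : embedding L0 W),
    (forall x, i0 x = i (k x)) ->
    forall f, resBM i0 f = resMM k (resBM i f);
  resMM_resMM : forall (M0 M1 M2 : closed_manifold R n)
    (k01 : embedding M0 M1) (k12 : embedding M1 M2) (k02 : embedding M0 M2),
    (forall x, k02 x = k12 (k01 x)) ->
    forall f, resMM k02 f = resMM k01 (resMM k12 f);

  pullB : forall M N M' N' (W : bordism M N) (W' : bordism M' N'),
    bordism_homeo W W' -> fieldB W' -> fieldB W;
  pullM : forall M M' : closed_manifold R n,
    homeomorphism M M' -> fieldM M' -> fieldM M;
  pullB_bij : forall M N M' N' (W : bordism M N) (W' : bordism M' N')
    (phi : bordism_homeo W W'), bijective (pullB phi);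
  pullM_bij : forall (M M' : closed_manifold R n) (phi : homeomorphism M M'),
    bijective (pullM phi);
  pullB_id : forall M N (W : bordism M N) (phi : bordism_homeo W W),
    (forall x, phi x = x) -> forall f, pullB phi f = f;
  pullM_id : forall (M : closed_manifold R n) (phi : homeomorphism M M),
    (forall x, phi x = x) -> forall f, pullM phi f = f;
  pullB_comp : forall M N M' N' M'' N''
    (W : bordism M N) (W' : bordism M' N') (W'' : bordism M'' N'')
    (phi : bordism_homeo W W') (psi : bordism_homeo W' W'')
    (chi : bordism_homeo W W''),
    (forall x, chi x = psi (phi x)) ->
    forall f, pullB chi f = pullB phi (pullB psi f);
  pullM_comp : forall (M M' M'' : closed_manifold R n)
    (phi : homeomorphism M M') (psi : homeomorphism M' M'')
    (chi : homeomorphism M M''),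
    (forall x, chi x = psi (phi x)) ->
    forall f, pullM chi f = pullM phi (pullM psi f);
  pullB_resBB : forall M0 N0 M N M0' N0' M' N'
    (W0 : bordism M0 N0) (W : bordism M N)
    (W0' : bordism M0' N0') (W' : bordism M' N')
    (j : subbordism W0 W) (j' : subbordism W0' W')
    (phi : bordism_homeo W W') (phi0 : bordism_homeo W0 W0'),
    (forall x, phi (j x) = j' (phi0 x)) ->
    forall f, resBB j (pullB phi f) = pullB phi0 (resBB j' f);
  pullB_resBM : forall M N M' N' (W : bordism M N) (W' : bordism M' N')
    (L L' : closed_manifold R n) (i : embedding L W) (i' : embedding L' W')
    (phi : bordism_homeo W W') (psi : homeomorphism L L'),
    (forall x, phi (i x) = i' (psi x)) ->
    forall f, resBM i (pullB phi f) = pullM psi (resBM i' f);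
  pullM_resMM : forall (M0 M M0' M' : closed_manifold R n)
    (k : embedding M0 M) (k' : embedding M0' M')
    (phi : homeomorphism M M') (phi0 : homeomorphism M0 M0'),
    (forall x, phi (k x) = k' (phi0 x)) ->
    forall f, resMM k (pullM phi f) = pullM phi0 (resMM k' f);

  fieldB_disj : forall M1 N1 M2 N2 M N
    (W1 : bordism M1 N1) (W2 : bordism M2 N2) (W : bordism M N)
    (j1 : subbordism W1 W) (j2 : subbordism W2 W),
    is_disjoint_union j1 j2 ->
    bijective (fun f : fieldB W => (resBB j1 f, resBB j2 f));
  fieldM_disj : forall (M1 M2 M : closed_manifold R n)
    (i1 : embedding M1 M) (i2 : embedding M2 M),
    is_disjoint_union_mfd i1 i2 ->
    bijective (fun f : fieldM M => (resMM i1 f, resMM i2 f));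

  fieldB_glue : forall M N P
    (W' : bordism M N) (W'' : bordism N P) (W : bordism M P)
    (j' : subbordism W' W) (j'' : subbordism W'' W),
    is_gluing j' j'' ->
    set_bij [set: fieldB W]
      [set g : fieldB W' * fieldB W'' |
        resBM (b_out W') g.1 = resBM (b_in W'') g.2]
      (fun f => (resBB j' f, resBB j'' f))
}.

Record action_system (F : field_system) (C : strict_monoidal_category) :=
  ActionSystem {
    action :> forall M N (W : bordism M N), fieldB F W -> Mor C;
    action_empty : forall M N (W : bordism M N) (p : fieldB F W),
      (W -> False) -> action p = idm (unitO C);
    action_disj : forall M1 N1 M2 N2 M N
      (W1 : bordism M1 N1) (W2 : bordism M2 N2) (W : bordism M N)
      (j1 : subbordism W1 W) (j2 : subbordism W2 W),
      is_disjoint_union j1 j2 -> forall f : fieldB F W,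
      action f = tensM (action (resBB j1 f)) (action (resBB j2 f));
    (* the right-hand side is asserted to be composable *)
    action_glue : forall M N P
      (W' : bordism M N) (W'' : bordism N P) (W : bordism M P)
      (j' : subbordism W' W) (j'' : subbordism W'' W),
      is_gluing j' j'' -> forall f : fieldB F W,
      exists e : dom (action (resBB j'' f)) = cod (action (resBB j' f)),
        action f = comp e;
    action_homeo : forall M N M' N' (W : bordism M N) (W' : bordism M' N')
      (phi : bordism_homeo W W') (f : fieldB F W'),
      action (pullB phi f) = action f
  }.

End ManifoldsWithBoundary.

Arguments action {R n F C} a {M N W} f.

Lemma void_opI : setI_closed [set: set void]. Proof. by []. Qed.
Lemma void_op_bigU (I : Type) (f : I -> set void) :
  (forall i, [set: set void] (f i)) -> [set: set void] (\bigcup_i f i).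
Proof. by []. Qed.
HB.instance Definition _ :=
  isOpenTopological.Build void (I : [set: set void] setT) void_opI void_op_bigU.

Section StateSums.
Variables (R : realType) (n : nat).

Lemma void_hausdorff : hausdorff_space void. Proof. by case. Qed.

Lemma void_second_countable : @second_countable void.
Proof.
exists set0; first exact: countable0.
by split; [move=> A | case].
Qed.

Lemma void_compact : compact [set: void].
Proof.
move=> G FG _.
by have [[]] := @filter_ex _ G FG setT filterT.
Qed.

Definition empty_manifold : closed_manifold R n :=
  @ClosedManifold R n void void_hausdorff void_second_countable
    (fun x => match x with end) void_compact.

Variables (S : completeSemiRingType) (C : strict_monoidal_category).

(* Q_S(C) *)
Definition Q := Mor C -> S.
Definition Qsum (I : Type) (q : I -> Q) : Q := fun x => csum (fun i => q i x).

Variable F : field_system R n.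

(* Z(M) is a subset of the functions fieldM F M -> Q; equations between
   elements of Z(M) are equations between the underlying functions. *)
Definition state_module (M : closed_manifold R n) : set (fieldM F M -> Q) :=
  [set z | forall phi : homeomorphism M M, isotopic_to_id R phi ->
             forall f, z (pullM phi f) = z f].

Definition state_pushforward (M N : closed_manifold R n)
    (phi : homeomorphism M N) (z : fieldM F M -> Q) : fieldM F N -> Q :=
  fun g => z (pullM phi g).

Lemma state_pushforward_module (M N : closed_manifold R n)
    (phi : homeomorphism M N) (z : fieldM F M -> Q) :
  state_module z -> state_module (state_pushforward phi z).
Proof.
move=> zM psi [H [Hc Hh H0 H1]] g; rewrite /state_pushforward.
pose chi := homeo_comp (homeo_sym phi) (homeo_comp psi phi).
rewrite -(@pullM_comp _ _ F _ _ _ phi psi (homeo_comp psi phi)) //.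
rewrite (@pullM_comp _ _ F _ _ _ chi phi (homeo_comp psi phi)); last first.
  by move=> x /=; rewrite homeo_invK.
apply: zM.
exists (fun p : R * M => homeo_inv phi (H (p.1, phi p.2))); split.
- apply/subspace_continuousP => -[t x] [/= tI _].
  pose k (p : R * M) : R * N := (p.1, phi p.2).
  have kc : {for (t, x), continuous k}.
    have := @cvg_pair _ _ _ (nbhs (t, x)) (nbhs t) (nbhs (phi x)) _ _ _
      fst (fun p => phi p.2).
    apply; first exact: cvg_fst.
    exact: (cvg_comp _ _ (@cvg_snd _ _ (nbhs t) (nbhs x) _)
                     (@homeo_continuous _ _ phi x)).
  apply: (@cvg_comp _ _ _ (fun p => H (k p)) (homeo_inv phi) _
            (nbhs (H (k (t, x))))); last first.
    exact: (@homeo_inv_continuous _ _ phi).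
  have /subspace_continuousP/(_ (k (t, x)) (conj tI I)) Hkc := Hc.
  move=> B /Hkc/kc kB; refine (@filterS _ (nbhs (t, x)) _ _ _ _ kB).
  by move=> [t' x'] /= kB' [t'I _]; apply: kB'.
- move=> t /Hh[h hH].
  by exists (homeo_comp (homeo_sym phi) (homeo_comp h phi)) => x /=; rewrite hH.
- by move=> x /=; rewrite H0 homeo_funK.
- by move=> x /=; rewrite H1.
Qed.

Variable T : action_system F C.

Definition char_action M N (W : bordism M N) (f : fieldB F W) : Q :=
  fun x => if `[< x = action T f >] then 1 else 0.

Definition coboundary (M : closed_manifold R n) := bordism empty_manifold M.

(* The boundary of W is the empty manifold together with M, so a field on it is
   a field on M, and restriction to it is restriction along b_out. *)
Definition state_sum (M : closed_manifold R n) (W : coboundary M) :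
    fieldM F M -> Q :=
  fun f => Qsum (fun G : {G : fieldB F W | resBM (b_out W) G = f} =>
                   char_action (sval G)).

Definition cob_equiv (M : closed_manifold R n) (W1 W2 : coboundary M) :=
  exists phi : homeomorphism W1 W2, forall x : M, phi (b_out W1 x) = b_out W2 x.

(* The library's [set] lives in too small a universe for sets of bordisms. *)
Definition Cob (M : closed_manifold R n) :=
  {c : coboundary M -> Prop | exists W, c = cob_equiv W}.

Definition Cob_repr (M : closed_manifold R n) (c : Cob M) : coboundary M :=
  projT1 (cid (svalP c)).

Definition Cob_class (M : closed_manifold R n) (W : coboundary M) : Cob M :=
  exist _ (cob_equiv W) (ex_intro _ W erefl).

Definition Cob_state_sum (M : closed_manifold R n) (c : Cob M) :=
  state_sum (Cob_repr c).

Lemma state_sum_equiv (M : closed_manifold R n) (W1 W2 : coboundary M) :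
  cob_equiv W1 W2 -> state_sum W1 = state_sum W2.
Proof.
move=> [h hout]; apply/funext => f; apply/funext => x.
have hin : h @` range (b_in W1) = range (b_in W2).
  by apply/seteqP; split => [_ [_ [[]]]|_ [[]]].
have hO : h @` range (b_out W1) = range (b_out W2).
  apply/seteqP; split => [_ [_ [y _ <-] <-]|_ [y _ <-]].
    by exists y.
  by exists (b_out W1 y).
pose phi := BordismHomeo hin hO.
have res_phi G : resBM (b_out W1) (pullB phi G) = resBM (b_out W2) G.
  rewrite (pullB_resBM (i := b_out W1) (i' := b_out W2) (phi := phi)
            (psi := homeo_id M) hout).
  by rewrite pullM_id.
have [u uK Ku] := pullB_bij F phi.
have pu G : resBM (b_out W1) G = f -> resBM (b_out W2) (u G) = f.
  by rewrite -res_phi Ku.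
have pp G : resBM (b_out W2) G = f -> resBM (b_out W1) (pullB phi G) = f.
  by rewrite res_phi.
rewrite /state_sum /Qsum.
rewrite -(@csum_reindex S _ {G : fieldB F W2 | resBM (b_out W2) G = f}
  (fun G => exist _ (pullB phi (sval G)) (pp _ (svalP G)))).
  congr csum; apply/funext => G /=.
  by rewrite /char_action action_homeo.
exists (fun G => exist _ (u (sval G)) (pu _ (svalP G))) => -[G e];
  by apply: eq_exist; rewrite /= ?uK ?Ku.
Qed.

(* independence of the choice of representatives *)
Lemma Cob_state_sumE (M : closed_manifold R n) (W : coboundary M) :
  Cob_state_sum (Cob_class W) = state_sum W.
Proof.
apply/esym/state_sum_equiv; rewrite /Cob_repr.
case: cid => W' /= E; have : cob_equiv W' W'.
  by exists (homeo_id _).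
by rewrite -E.
Qed.

Definition coboundary_aggregate (M : closed_manifold R n) : fieldM F M -> Q :=
  fun f => Qsum (fun c : Cob M => Cob_state_sum c f).

End StateSums.

Arguments state_module {R n} S C {F} M.
Arguments state_pushforward {R n S C F M N} phi z.
Arguments coboundary_aggregate {R n} S {C F} T M.

(* Main.v *)
Require Import Defs.
From mathcomp Require Import all_boot all_order all_algebra.
From mathcomp Require Import all_classical all_reals all_analysis.

(** The aggregate [A(M)] is a sum over all coboundaries of [M], and a
    homeomorphism [phi : M -> N] identifies the coboundaries of [M] with those
    of [N]: keep the total space [W] and precompose the identification of the
    boundary with [phi^-1].  The identity of the total space is then a
    homeomorphism of bordisms lying over [phi] on the boundary.  Pulling fields
    back along it preserves the action exponentials and matches the fields
    restricting to [g] on [N] with those restricting to [phi^* g] on [M], so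
    that corresponding coboundaries have corresponding state sums
    ([state_sum_over]).  Since the correspondence is a bijection of equivalence
    classes ([Cob_push_bij]), the two aggregates are reindexings of the same
    sum.

    Everything is organised around one relation, [cob_over phi W V]: some
    homeomorphism [W -> V] restricts to [phi] on the boundary.  It contains
    [cob_equiv] as the case where [phi] is the identity, and it is closed
    under composition and inversion, which replaces all manipulation of
    equivalence classes by composition of homeomorphisms. *)

Set Implicit Arguments.
Unset Strict Implicit.
Unset Printing Implicit Defensive.

Local Open Scope classical_set_scope.

Section EmbeddingAlongHomeomorphism.
Variables (X Y Z : topologicalType) (e : embedding Y Z) (h : homeomorphism X Y).

Lemma embedding_homeo_inj : injective (e \o h).
Proof. exact: inj_comp (@emb_inj _ _ e) (can_inj (homeo_funK h)). Qed.

Lemma embedding_homeo_open (U : set X) :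
  open U <-> exists2 V : set Z, open V & U = (e \o h) @^-1` V.
Proof.
split=> [oU | [V oV ->]].
  have : open (homeo_inv h @^-1` U).
    by apply: open_comp => // x _; exact: homeo_inv_continuous.
  move=> /(emb_open e)[V oV UV]; exists V => //.
  rewrite comp_preimage -UV; apply/funext => x.
  by rewrite /preimage /= homeo_funK.
rewrite comp_preimage; apply: open_comp.
  by move=> x _; exact: homeo_continuous.
by apply/(emb_open e); exists V.
Qed.

Definition embedding_homeo : embedding X Z :=
  Embedding embedding_homeo_inj embedding_homeo_open.

Lemma range_embedding_homeo : range embedding_homeo = range e.
Proof.
apply/seteqP; split=> [_ [x _ <-] | _ [y _ <-]]; first by exists (h x).
by exists (homeo_inv h y) => //=; rewrite homeo_invK.
Qed.

End EmbeddingAlongHomeomorphism.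

Section Coboundaries.
Variables (R : realType) (n : nat).
Implicit Types M N P : closed_manifold R n.

Definition cob_over M N (phi : homeomorphism M N)
    (W : coboundary M) (V : coboundary N) :=
  exists h : homeomorphism W V, forall x : M, h (b_out W x) = b_out V (phi x).

Lemma cob_over_sym M N (phi : homeomorphism M N) W V :
  cob_over phi W V -> cob_over (homeo_sym phi) V W.
Proof.
move=> [h hE]; exists (homeo_sym h) => y /=.
by rewrite -{1}(homeo_invK phi y) -hE homeo_funK.
Qed.

Lemma cob_over_comp M N P (phi : homeomorphism M N) (psi : homeomorphism N P)
    W V U :
  cob_over phi W V -> cob_over psi V U -> cob_over (homeo_comp psi phi) W U.
Proof.
move=> [h hE] [k kE]; exists (homeo_comp k h) => x /=.
by rewrite hE kE.
Qed.

Lemma cob_over_id M (phi : homeomorphism M M) (W V : coboundary M) :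
  (forall x, phi x = x) -> cob_over phi W V -> cob_equiv W V.
Proof. by move=> phiE [h hE]; exists h => x; rewrite hE phiE. Qed.

Section Reparametrize.
Variables (M N : closed_manifold R n) (phi : homeomorphism M N).
Variable W : coboundary M.

Let out := embedding_homeo (b_out W) (homeo_sym phi).

Lemma reparam_boundary :
  range (b_in W) `|` range out = @manifold_boundary R n W.
Proof. by rewrite range_embedding_homeo b_boundary. Qed.

Lemma reparam_disjoint : range (b_in W) `&` range out = set0.
Proof. by rewrite range_embedding_homeo b_disjoint. Qed.

Definition reparam : coboundary N :=
  Bordism (@b_hausdorff _ _ _ _ W) (@b_second_countable _ _ _ _ W)
    (@b_half_euclidean _ _ _ _ W) (@b_compact _ _ _ _ W)
    reparam_boundary reparam_disjoint.

Lemma reparam_over : cob_over phi W reparam.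
Proof. by exists (homeo_id W) => x /=; rewrite homeo_funK. Qed.

End Reparametrize.

Lemma Cob_repr_class M (W : coboundary M) :
  cob_equiv W (Cob_repr (Cob_class W)).
Proof.
rewrite /Cob_repr; case: cid => V /= ->.
by exists (homeo_id V).
Qed.

Lemma Cob_repr_inj M (c d : Cob M) :
  cob_equiv (Cob_repr c) (Cob_repr d) -> c = d.
Proof.
case: c d => [c hc] [d hd]; rewrite /Cob_repr.
case: cid => W /= cE; case: cid => V /= dE WV.
apply: eq_exist; rewrite cE dE.
have VW : cob_equiv V W := @cob_over_sym _ _ (homeo_id M) _ _ WV.
apply/funext => U; apply/propext; split=> [WU|VU].
- exact: (@cob_over_comp _ _ _ (homeo_id M) (homeo_id M) _ _ _ VW WU).
- exact: (@cob_over_comp _ _ _ (homeo_id M) (homeo_id M) _ _ _ WV VU).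
Qed.

Definition Cob_push M N (phi : homeomorphism M N) (c : Cob M) : Cob N :=
  Cob_class (reparam phi (Cob_repr c)).

(** The chosen representative of the pushed class need not be the
    reparametrized manifold, but it still lies over [phi]; every other property
    of [Cob_push] is deduced from this one. *)
Lemma Cob_push_over M N (phi : homeomorphism M N) (c : Cob M) :
  cob_over phi (Cob_repr c) (Cob_repr (Cob_push phi c)).
Proof.
exact: (@cob_over_comp _ _ _ phi (homeo_id N) _ _ _
          (reparam_over phi (Cob_repr c)) (Cob_repr_class _)).
Qed.

Lemma Cob_pushK M N (phi : homeomorphism M N) (psi : homeomorphism N M) :
  cancel phi psi -> cancel (Cob_push phi) (Cob_push psi).
Proof.
move=> phiK c; apply/esym/Cob_repr_inj.
apply: (@cob_over_id _ (homeo_comp psi phi)) => //.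
exact: cob_over_comp (Cob_push_over phi c) (Cob_push_over psi _).
Qed.

Lemma Cob_push_bij M N (phi : homeomorphism M N) : bijective (Cob_push phi).
Proof.
exists (Cob_push (homeo_sym phi)); apply: Cob_pushK.
- exact: homeo_funK.
- exact: homeo_invK.
Qed.

Section StateSums.
Variables (S : completeSemiRingType) (C : strict_monoidal_category).
Variables (F : field_system R n) (T : action_system F C).

(** A homeomorphism over [phi] pulls fields on [V] restricting to [g] back to
    fields on [W] restricting to [phi^* g]; as [phi^*] is injective on fields of
    the boundary, this is a bijection between the index sets of the two sums,
    and it preserves the summands because the action is homeomorphism
    invariant. *)
Lemma state_sum_over M N (phi : homeomorphism M N) W V (g : fieldM F N) :
  cob_over phi W V ->
  state_sum S T W (pullM phi g) = state_sum S T V g.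
Proof.
move=> [h hout]; apply/funext => x.
have hin : h @` range (b_in W) = range (b_in V).
  (* both incoming boundaries are images of the empty manifold *)
  by apply/seteqP; split => [_ [_ [[]]]|_ [[]]].
have hO : h @` range (b_out W) = range (b_out V).
  apply/seteqP; split => [_ [_ [y _ <-] <-]|_ [y _ <-]].
    by rewrite hout; exists (phi y).
  exists (b_out W (homeo_inv phi y)); first by exists (homeo_inv phi y).
  by rewrite hout homeo_invK.
pose hB := BordismHomeo hin hO.
have res_pull G : resBM (b_out W) (pullB hB G) = pullM phi (resBM (b_out V) G).
  exact: pullB_resBM.
have [u uK Ku] := pullB_bij F hB.
have pull_fibre G :
    resBM (b_out V) G = g -> resBM (b_out W) (pullB hB G) = pullM phi g.
  by rewrite res_pull => ->.
have push_fibre G :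
    resBM (b_out W) G = pullM phi g -> resBM (b_out V) (u G) = g.
  by rewrite -{1}(Ku G) res_pull => /(bij_inj (pullM_bij F phi)).
rewrite /state_sum /Qsum.
rewrite -(@csum_reindex S _ {G : fieldB F V | resBM (b_out V) G = g}
  (fun G => exist _ (pullB hB (sval G)) (pull_fibre _ (svalP G)))).
  congr csum; apply/funext => G /=.
  by rewrite /char_action action_homeo.
exists (fun G => exist _ (u (sval G)) (push_fibre _ (svalP G))) => -[G e];
  by apply: eq_exist; rewrite /= ?uK ?Ku.
Qed.

End StateSums.
End Coboundaries.

Theorem theorem6p12 (R : realType) (n : nat) (S : completeSemiRingType)
    (C : strict_monoidal_category) (F : field_system R n)
    (T : action_system F C) (M N : closed_manifold R n)
    (phi : homeomorphism M N) :
  state_pushforward phi (coboundary_aggregate S T M) =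
  coboundary_aggregate S T N.
Proof.
apply/funext => g; apply/funext => x.
rewrite /state_pushforward /coboundary_aggregate /Qsum.
rewrite -[RHS](csum_reindex _ (Cob_push_bij phi)).
congr csum; apply/funext => c.
by rewrite /Cob_state_sum (state_sum_over S T g (Cob_push_over phi c)).
Qed.
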